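(* Let $A\in\mathbb{R}^{m\times n}$ and $1\le k\le l<\min(m,n)$. Let $\Pi$ be a permutation matrix and $$A\Pi=Q\begin{pmatrix}R_{11}&R_{12}\\0&R_{22}\end{pmatrix}$$ a partial QR factorization with $Q\in\mathbb{R}^{m\times m}$ orthogonal and $R_{11}\in\mathbb{R}^{l\times l}$ upper triangular and invertible. Let $\widetilde R=(R_{11}\ \ R_{12})$, let $\widetilde R_k$ be the rank-$k$ truncated SVD of $\widetilde R$, and let $$\widehat R=\begin{pmatrix}R_{11}&a\\0&\alpha\end{pmatrix}\in\mathbb{R}^{(l+1)\times(l+1)}$$ be the leading $(l+1)\times(l+1)$ submatrix obtained after one step of QRCP or RQRCP on $R_{22}$ (see context), with $\alpha\ne 0$. Define $$g_1=\frac{\|R_{22}\|_{1,2}}{|\alpha|},\qquad g_2=|\alpha|\,\|\widehat R^{-T}\|_{1,2},$$ $$\tau=g_1g_2\,\frac{\|R_{22}\|_2}{\|R_{22}\|_{1,2}}\,\frac{\|\widehat R^{-T}\|_{1,2}^{-1}}{\sigma_{l+1}(A)},\qquad \widehat\tau=g_1g_2\,\frac{\|R_{22}\|_2}{\|R_{22}\|_{1,2}}\,\frac{\|R_{11}^{-T}\|_{1,2}^{-1}}{\sigma_l(\widetilde R)},\qquad \overline\tau=\widehat\tau\,\frac{\sigma_l(\widetilde R)}{\sigma_k(\widetilde R)} .$$ Then $$\tau\le g_1g_2\sqrt{(l+1)(n-l)},\qquad \widehat\tau\le g_1g_2\sqrt{l(n-l)},$$ for every $1\le j\le k$, $$\sigma_j(\widetilde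 R)\ \ge\ \frac{\sigma_j(A)}{\sqrt{1+\min\left(\overline\tau^2,\ \tau^2(1+\overline\tau^2)\left(\frac{\sigma_{l+1}(A)}{\sigma_j(A)}\right)^2\right)}},$$ and $$\left\|A\Pi-Q\begin{pmatrix}\widetilde R_k\\0\end{pmatrix}\right\|_2\ \le\ \sigma_{k+1}(A)\sqrt{1+\tau^2\left(\frac{\sigma_{l+1}(A)}{\sigma_{k+1}(A)}\right)^2}.$$
   Context: $\sigma_j(X)$ is the $j$-th largest singular value of $X$; $\|X\|_2$ is the spectral norm; $\|X\|_{1,2}$ is the largest Euclidean norm of a column of $X$; $X^{-T}=(X^{-1})^T$. One step of QRCP or RQRCP on $R_{22}\in\mathbb{R}^{(m-l)\times(n-l)}$ means: select a column of $R_{22}$, interchange it with the first column of $R_{22}$ (and interchange the corresponding columns of $R_{12}$ accordingly), and apply a Householder reflection to the rows of $R_{22}$ so that its first column becomes $(\alpha,0,\dots,0)^T$; $a\in\mathbb{R}^l$ is then the corresponding first column of the permuted $R_{12}$. In QRCP the selected column is one of largest Euclidean norm in $R_{22}$; in RQRCP it is the column whose index maximizes the Euclidean norms of the columns of a random sketch $\Omega' R_{22}$, where $\Omega'$ is a Gaussian matrix having fewer rows than $R_{22}$. The norms $\|R_{22}\|_2$ and $\|R_{22}\|_{1,2}$ are unchanged by this step, as are the singular values of $\widetilde R$. *)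

(* Defs.v *)
From HB Require Import structures.
From mathcomp Require Import all_boot all_order all_algebra.
From mathcomp Require Import all_classical all_reals all_analysis.

Set Implicit Arguments.
Unset Strict Implicit.
Unset Printing Implicit Defensive.

Import Order.TTheory GRing.Theory Num.Theory.
Local Open Scope classical_set_scope.
Local Open Scope ring_scope.

(* MathComp-Analysis puts the max norm on matrices, hence the separate
   Euclidean norm of a column vector. *)
Definition enorm (R : realType) (p : nat) (v : 'cV[R]_p) : R :=
  Num.sqrt (\sum_i v i 0 ^+ 2).

Definition orthogonal_mx (R : realType) (p : nat) (Q : 'M[R]_p) : Prop :=
  Q^T *m Q = 1%:M.

(* The list is unique; it exists when G has only real eigenvalues, in
   particular when G is symmetric. *)
Definition eigenvalue_seq (R : realType) (q : nat) (G : 'M[R]_q) : seq R :=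
  xget [::] [set s : seq R |
    sorted (fun x y : R => y <= x) s /\
    char_poly G = \prod_(x <- s) ('X - x%:P)].

(* Indexing is 1-based: the largest singular value is [sigma 1 X]. The value
   is 0 for j larger than the number of columns. *)
Definition sigma (R : realType) (j p q : nat) (X : 'M[R]_(p, q)) : R :=
  Num.sqrt (nth 0 (eigenvalue_seq (X^T *m X)) j.-1).

Definition norm2 (R : realType) (p q : nat) (X : 'M[R]_(p, q)) : R :=
  sigma 1 X.

Definition norm12 (R : realType) (p q : nat) (X : 'M[R]_(p, q)) : R :=
  \big[Num.max/0]_(j < q) enorm (col j X).

Definition rect_diag_mx (R : realType) (p q : nat) (s : nat -> R) :
    'M[R]_(p, q) :=
  \matrix_(i, j) (if (i : nat) == j then s i else 0).

(* A relation, since U and V (and Y itself, when the k-th and (k+1)-st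
   singular values coincide) are not determined by X. *)
Definition truncated_svd (R : realType) (k p q : nat) (X Y : 'M[R]_(p, q)) :
    Prop :=
  exists (U : 'M[R]_p) (V : 'M[R]_q),
    [/\ orthogonal_mx U, orthogonal_mx V,
        X = U *m rect_diag_mx p q (fun i => sigma i.+1 X) *m V^T
      & Y = U *m rect_diag_mx p q
                   (fun i => if (i < k)%N then sigma i.+1 X else 0) *m V^T].

Definition is_householder (R : realType) (p : nat) (H : 'M[R]_p) : Prop :=
  exists v : 'cV[R]_p,
    v != 0 /\ H = 1%:M - (2 / (v^T *m v) 0 0) *: (v *m v^T).

(* Independent standard normal entries; since the family is finite and the B's
   may be the whole line, the product rule below is mutual independence. *)
Definition gaussian_matrix (R : realType) (d : measure_display)
    (T : measurableType d) (P : probability T R) (r p : nat)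
    (Omega : 'I_r -> 'I_p -> {RV P >-> R}) : Prop :=
  (forall i j (B : set R), measurable B ->
     P (Omega i j @^-1` B) = normal_prob 0 1 B) /\
  (forall B : 'I_r -> 'I_p -> set R, (forall i j, measurable (B i j)) ->
     P [set w | forall i j, B i j (Omega i j w)] =
     \big[*%E/1%E]_(i < r) \big[*%E/1%E]_(j < p) P (Omega i j @^-1` B i j)).

Definition max_norm_column (R : realType) (p q : nat) (X : 'M[R]_(p, q))
    (j : 'I_q) : Prop :=
  forall j', enorm (col j' X) <= enorm (col j X).

(* For RQRCP, w is the outcome at which the random sketching matrix is
   drawn. *)
Variant pivot_column (R : realType) (p q : nat) (X : 'M[R]_(p, q))
    (j : 'I_q) : Prop :=
| QRCP_pivot of max_norm_column X j
| RQRCP_pivot (d : measure_display) (T : measurableType d)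
    (P : probability T R) (r : nat) (Omega : 'I_r -> 'I_p -> {RV P >-> R})
    (w : T) of (0 < r < p)%N & gaussian_matrix Omega &
    max_norm_column ((\matrix_(i, i') Omega i i' w) *m X) j.

(* j0 is the index of the first column; H is applied after the interchange. *)
Definition qr_pivot_step (R : realType) (l p q : nat) (R12 : 'M[R]_(l, q))
    (R22 : 'M[R]_(p, q)) (a : 'cV[R]_l) (alpha : R) : Prop :=
  exists (j0 j : 'I_q) (H : 'M[R]_p),
    [/\ j0 = 0%N :> nat, pivot_column R22 j, is_householder H,
        col j0 (H *m xcol j0 j R22) =
          \col_i (if (i : nat) == 0%N then alpha else 0)
      & a = col j0 (xcol j0 j R12)].

(* Retypes a matrix assembled from blocks of heights l, m - l and widths
   l, n - l as an m x n matrix. *)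
Definition blocks_mx (R : realType) (l m n : nat) (hm : (l < m)%N)
    (hn : (l < n)%N) (M : 'M[R]_(l + (m - l), l + (n - l))) : 'M[R]_(m, n) :=
  castmx (subnKC (ltnW hm), subnKC (ltnW hn)) M.

(* Main.v *)
Require Import Defs.
From HB Require Import structures.
From mathcomp Require Import all_boot all_order all_algebra.
From mathcomp Require Import all_classical all_reals all_analysis.
From mathcomp Require Import fingroup perm.
From mathcomp Require complex.
From mathcomp Require Import ring lra.

Set Implicit Arguments.
Unset Strict Implicit.
Unset Printing Implicit Defensive.

Import Order.TTheory GRing.Theory Num.Theory.
Local Open Scope ring_scope.

(** Write M for the block matrix with blocks R11, R12, 0, R22, write Rt for its
    block row (R11 R12), and h, h1 for the largest row norms of the inverses of
    Rh and R11. Since A is M multiplied by orthogonal matrices on both sides,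
    A and M have the same singular values. All factors of tau cancel except
    tau = |R22| / sigma_(l+1)(A), and h1 <= h gives taub >= |R22| / sigma_k(Rt).
    Everything then rests on three facts.

    - Deleting rows: |M u|^2 = |Rt u|^2 + |R22 u2|^2, u2 being the lower part
      of u, so sigma_j(Rt) <= sigma_j(M) and
      sigma_j(M)^2 <= sigma_j(Rt)^2 + |R22|^2
      ([sigma_row_block_le], [sigma_partial_qr_le]). Dividing the last
      inequality by sigma_j(Rt)^2 gives the lower bounds on sigma_j(Rt)
      ([sigma_lower_bound_scalar]).
    - The error of the truncation is M with Rt replaced by Rt - Rt_k, whose
      norm is at most sigma_(k+1)(Rt); hence its square is at most
      sigma_(k+1)(A)^2 + |R22|^2 ([truncation_error_le]).
    - The pivot column of M together with the first l columns has, after the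
      reflection, the nonzero part Rh, so sigma_(l+1)(M) is at least the
      smallest singular value of Rh, which is at least 1 / (sqrt (l+1) h); in
      the same way sigma_l(Rt) >= 1 / (sqrt l h1) ([sigma_pivot_ge],
      [sigma_row_block_ge]). With |R22| <= sqrt (n-l) |R22|_(1,2) this bounds
      tau and tauh.

    All comparisons of singular values come from half of the
    Courant-Fischer theorem: a subspace of dimension j on which |X w|^2 >=
    c |w|^2 forces sigma_j(X)^2 >= c ([sigma_ge]), and c = sigma_j(X)^2 is
    attained ([sigma_witness]). Subspaces are given by matrices W with
    orthonormal columns. Both statements are read off an orthonormal basis of
    eigenvectors of X^T X ([singular_basis]), which the spectral theorem for
    real symmetric matrices provides ([symmetric_orthogonal_diag]). *)

(** * Euclidean and column norms *)

(** The squared Euclidean norm, kept free of square roots since all the estimates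
    are between squares. *)
Definition sqnorm (R : realType) (p : nat) (v : 'cV[R]_p) : R :=
  \sum_i v i 0 ^+ 2.

Lemma sqnormE (R : realType) p (v : 'cV[R]_p) : sqnorm v = (v^T *m v) 0 0.
Proof. by rewrite mxE; apply: eq_bigr => i _; rewrite mxE expr2. Qed.

Lemma sqnorm_ge0 (R : realType) p (v : 'cV[R]_p) : 0 <= sqnorm v.
Proof. by apply: sumr_ge0 => i _; rewrite sqr_ge0. Qed.

Lemma sqnorm_gt0 (R : realType) p (v : 'cV[R]_p) : v != 0 -> 0 < sqnorm v.
Proof.
move=> v0; rewrite lt_def sqnorm_ge0 andbT; apply: contra v0.
rewrite psumr_eq0 => [/allP v0|i _]; last exact: sqr_ge0.
apply/eqP/colP => i; rewrite mxE.
by have := v0 i (mem_index_enum i); rewrite /= sqrf_eq0 => /eqP.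
Qed.

Lemma enorm_sqr (R : realType) p (v : 'cV[R]_p) : enorm v ^+ 2 = sqnorm v.
Proof. by rewrite sqr_sqrtr ?sqnorm_ge0. Qed.

Lemma sqnorm_isometry (R : realType) p q (W : 'M[R]_(p, q)) (u : 'cV_q) :
  W^T *m W = 1%:M -> sqnorm (W *m u) = sqnorm u.
Proof. by move=> WW; rewrite !sqnormE trmx_mul -mulmxA (mulmxA W^T) WW mul1mx. Qed.

Lemma sqnorm_col_mx (R : realType) p q (u : 'cV[R]_p) (v : 'cV[R]_q) :
  sqnorm (col_mx u v) = sqnorm u + sqnorm v.
Proof.
by rewrite /sqnorm big_split_ord; congr (_ + _); apply: eq_bigr => i _;
  rewrite ?col_mxEu ?col_mxEd.
Qed.

Lemma sqnormZ (R : realType) p (c : R) (v : 'cV[R]_p) :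
  sqnorm (c *: v) = c ^+ 2 * sqnorm v.
Proof. by rewrite /sqnorm mulr_sumr; apply: eq_bigr => i _; rewrite mxE exprMn. Qed.

(** Lagrange's identity: twice the difference of the two sides is the sum of the
    squares of the a_i b_j - a_j b_i. *)
Lemma cauchy_schwarz (R : realType) (I : finType) (a b : I -> R) :
  (\sum_i a i * b i) ^+ 2 <= (\sum_i a i ^+ 2) * (\sum_i b i ^+ 2).
Proof.
have : 0 <= \sum_i \sum_j (a i * b j - a j * b i) ^+ 2.
  by apply: sumr_ge0 => i _; apply: sumr_ge0 => j _; apply: sqr_ge0.
have sqrE i j : (a i * b j - a j * b i) ^+ 2 =
    a i ^+ 2 * b j ^+ 2 + b i ^+ 2 * a j ^+ 2 - 2 * (a i * b i) * (a j * b j).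
  by ring.
under eq_bigr => i _ do under eq_bigr => j _ do rewrite sqrE.
under eq_bigr => i _ do rewrite sumrB big_split /= -!mulr_sumr.
rewrite sumrB big_split /= -!mulr_suml -mulr_sumr; lra.
Qed.

Lemma sqnorm_mulmx_frobenius (R : realType) p q (X : 'M[R]_(p, q)) (u : 'cV_q) :
  sqnorm (X *m u) <= (\sum_j \sum_i X i j ^+ 2) * sqnorm u.
Proof.
rewrite exchange_big mulr_suml; apply: ler_sum => i _.
rewrite mxE; exact: cauchy_schwarz.
Qed.

Lemma norm12_ge0 (R : realType) p q (X : 'M[R]_(p, q)) : 0 <= norm12 X.
Proof. by apply: bigmax_ge_id. Qed.

Lemma sqnorm_col_le (R : realType) p q (X : 'M[R]_(p, q)) j :
  \sum_i X i j ^+ 2 <= norm12 X ^+ 2.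
Proof.
have -> : \sum_i X i j ^+ 2 = enorm (col j X) ^+ 2.
  by rewrite enorm_sqr; apply: eq_bigr => i _; rewrite mxE.
rewrite ler_sqr ?nnegrE ?norm12_ge0 ?sqrtr_ge0 //.
by rewrite /norm12 (bigmaxD1 j) //= le_max lexx.
Qed.

Lemma sqnorm_mulmx_norm12 (R : realType) p q (X : 'M[R]_(p, q)) (u : 'cV_q) :
  sqnorm (X *m u) <= q%:R * norm12 X ^+ 2 * sqnorm u.
Proof.
apply: le_trans (sqnorm_mulmx_frobenius X u) _.
rewrite ler_wpM2r ?sqnorm_ge0 // mulr_natl -[X in _ *+ X]card_ord -sumr_const.
by apply: ler_sum => j _; apply: sqnorm_col_le.
Qed.

Lemma sqnorm_mulmx_norm12_tr (R : realType) p q (X : 'M[R]_(p, q)) (u : 'cV_q) :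
  sqnorm (X *m u) <= p%:R * norm12 X^T ^+ 2 * sqnorm u.
Proof.
apply: le_trans (sqnorm_mulmx_frobenius X u) _; rewrite exchange_big.
rewrite ler_wpM2r ?sqnorm_ge0 // mulr_natl -[X in _ *+ X]card_ord -sumr_const.
apply: ler_sum => j _; apply: le_trans (sqnorm_col_le X^T j).
by under [X in _ <= X]eq_bigr do rewrite mxE.
Qed.

Lemma norm12_tr_block_ge (R : realType) p q r (B : 'M[R]_(p, q)) (C : 'M[R]_(p, r))
    (D : 'M[R]_(r, q)) (E : 'M[R]_(r, r)) :
  norm12 B^T <= norm12 (block_mx B C D E)^T.
Proof.
apply/bigmax_leP; split=> [|j _]; first exact: norm12_ge0.
apply: (@le_trans _ _ (enorm (col (lshift r j) (block_mx B C D E)^T))).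
  rewrite ler_sqrt ?sqnorm_ge0 //.
  rewrite [leRHS]big_split_ord /=.
  under [X in _ <= X + _]eq_bigr do rewrite mxE mxE block_mxEul.
  under eq_bigr do rewrite !mxE.
  by rewrite lerDl; apply: sumr_ge0 => i _; apply: sqr_ge0.
by rewrite /norm12 (bigmaxD1 (lshift r j)) //= le_max lexx.
Qed.

(** * Real symmetric matrices *)

Lemma householder_orthogonal (R : realType) p (H : 'M[R]_p) :
  is_householder H -> orthogonal_mx H.
Proof.
case=> v [v0 ->]; rewrite -sqnormE /orthogonal_mx.
set c := 2 / _.
have cv : c * sqnorm v = 2 by rewrite divfK // gt_eqF // sqnorm_gt0.
have vvv : v *m v^T *m (v *m v^T) = sqnorm v *: (v *m v^T).
  rewrite -mulmxA (mulmxA v^T) [v^T *m v]mx11_scalar -sqnormE.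
  by rewrite mul_scalar_mx -scalemxAr.
rewrite [_^T]linearB /= [X in X - _]trmx1 [(c *: _)^T]linearZ /=.
rewrite trmx_mul trmxK mulmxBl mul1mx.
rewrite -scalemxAl mulmxBr mulmx1 -scalemxAr vvv scalerBr !scalerA mulrAC cv.
by rewrite (_ : 2 * c = c + c) ?mulr_natl ?mulr2n // scalerDl opprB addrK subrK.
Qed.

(** The reflection in the hyperplane orthogonal to v - e_1 exchanges the unit
    vectors e_1 and v. *)
Lemma orthogonal_first_col (R : realType) p (v : 'cV[R]_(1 + p)) :
  sqnorm v = 1 ->
  exists2 Q : 'M[R]_(1 + p), orthogonal_mx Q & Q *m delta_mx 0 0 = v.
Proof.
move=> v1; set e : 'cV[R]_(1 + p) := delta_mx 0 0.
have [ve|ve] := eqVneq v e.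
  by exists 1%:M; rewrite ?mul1mx // /orthogonal_mx trmx1 mul1mx.
have u0 : v - e != 0 by rewrite subr_eq0.
exists (1%:M - (2 / ((v - e)^T *m (v - e)) 0 0) *: ((v - e) *m (v - e)^T)).
  by apply: householder_orthogonal; exists (v - e).
have e1 : (e^T *m e) 0 0 = 1 by rewrite trmx_delta mul_delta_mx mxE.
have ev : (e^T *m v) 0 0 = v 0 0 by rewrite trmx_delta -rowE mxE.
have ve' : (v^T *m e) 0 0 = v 0 0 by rewrite -colE !mxE.
have subE (A B : 'M[R]_1) : (A - B) 0 0 = A 0 0 - B 0 0 by rewrite !mxE.
have uu : ((v - e)^T *m (v - e)) 0 0 = 2 * (1 - v 0 0).
  rewrite [(v - e)^T]linearB /= mulmxBl !mulmxBr !subE ve' ev e1 -sqnormE v1.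
  by ring.
have ue : (v - e)^T *m e = (v 0 0 - 1)%:M.
  by rewrite [LHS]mx11_scalar [(v - e)^T]linearB /= mulmxBl subE ve' e1.
have : ((v - e)^T *m (v - e)) 0 0 != 0 by rewrite -sqnormE gt_eqF // sqnorm_gt0.
rewrite uu mulf_eq0 negb_or => /andP[_ h].
rewrite mulmxBl mul1mx -scalemxAl -mulmxA ue mul_mx_scalar scalerA.
have -> : 2 / (2 * (1 - v 0 0)) * (v 0 0 - 1) = -1 by field.
by rewrite scaleN1r opprK addrC subrK.
Qed.

Section RealEigenvalue.
Import complex.
Local Open Scope complex_scope.

(** Over the complex numbers a real symmetric matrix is Hermitian, hence
    unitarily diagonalizable with real eigenvalues; a real root of the complex
    characteristic polynomial is a root of the real one. *)
Lemma symmetric_eigenvalue (R : realType) p (G : 'M[R]_p.+1) :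
  G^T = G -> exists x, eigenvalue G x.
Proof.
move=> Gsym; set Gc := map_mx (real_complex R) G.
have Gh : Gc \is hermsymmx.
  apply: realsym_hermsym.
    by apply/is_hermitianmxP; rewrite expr0 scale1r map_mx_id // map_trmx Gsym.
  by apply/mxOverP => i j; rewrite mxE complex_real.
have /hermitian_normalmx/orthomx_spectralP Gd := Gh.
have /mxOverP /(_ 0 0)/complex_realP[x dx] := hermitian_spectral_diag_real Gh.
have Pu := spectral_unit Gc.
move: Gd dx Pu; set P := spectralmx Gc; set d := spectral_diag Gc => Gd dx Pu.
exists x; rewrite eigenvalue_root_char -(fmorph_root (real_complex R)) map_char_poly.
rewrite -eigenvalue_root_char -/Gc; apply/eigenvalueP; exists (row 0 P).
  rewrite -row_mul {1}Gd !mulmxA mulmxV // mul1mx.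
  by apply/rowP => j; rewrite mul_diag_mx !mxE dx.
apply/eqP => r0.
have : row 0 P *m invmx P = 0 by rewrite r0 mul0mx.
rewrite -row_mul mulmxV // => /rowP/(_ 0); rewrite !mxE eqxx => /eqP.
by rewrite oner_eq0.
Qed.
End RealEigenvalue.


Lemma orthogonal_mxC (R : realType) p (V : 'M[R]_p) :
  orthogonal_mx V -> V *m V^T = 1%:M.
Proof. exact: mulmx1C. Qed.

Lemma orthogonal_mxM (R : realType) p (U V : 'M[R]_p) :
  orthogonal_mx U -> orthogonal_mx V -> orthogonal_mx (U *m V).
Proof.
by rewrite /orthogonal_mx => UU VV; rewrite trmx_mul -mulmxA (mulmxA U^T) UU mul1mx.
Qed.

Lemma symmetric_unit_eigenvector (R : realType) p (G : 'M[R]_p.+1) :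
  G^T = G -> exists (x : R) (v : 'cV[R]_p.+1), sqnorm v = 1 /\ G *m v = x *: v.
Proof.
move=> Gsym; have [x /eigenvalueP[v vG v0]] := symmetric_eigenvalue Gsym.
have vT0 : v^T != 0 by rewrite trmx_eq0.
exists x, ((Num.sqrt (sqnorm v^T))^-1 *: v^T); split.
  by rewrite sqnormZ exprVn sqr_sqrtr ?sqnorm_ge0 // mulVf // gt_eqF // sqnorm_gt0.
by rewrite -scalemxAr -{1}Gsym -trmx_mul vG linearZ /= !scalerA mulrC.
Qed.

(** The spectral theorem, by deflation: in an orthonormal basis that begins with
    an eigenvector for x, the matrix of G is block diagonal with blocks x and a
    smaller symmetric matrix. *)
Lemma symmetric_orthogonal_diag (R : realType) p (G : 'M[R]_p) :
  G^T = G ->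
  exists (V : 'M[R]_p) (d : 'rV[R]_p),
    orthogonal_mx V /\ G = V *m diag_mx d *m V^T.
Proof.
elim: p G => [|p IHp] G Gsym.
  exists 0, 0; split; first by apply/matrixP => -[].
  by apply/matrixP => -[].
have [x [v [v1 Gv]]] := symmetric_unit_eigenvector Gsym.
have [Q QQ Qe] := @orthogonal_first_col R p v v1.
have QQ' := orthogonal_mxC QQ.
pose G' : 'M[R]_(1 + p) := Q^T *m G *m Q.
have G'sym : G'^T = G' by rewrite /G' !trmx_mul trmxK Gsym mulmxA.
have G'e : G' *m delta_mx 0 0 = x *: delta_mx 0 0 :> 'cV_(1 + p).
  rewrite /G' -mulmxA Qe -mulmxA Gv -scalemxAr; congr (_ *: _).
  by rewrite -Qe mulmxA QQ mul1mx.
have GE : G = Q *m G' *m Q^T.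
  by rewrite /G' !mulmxA QQ' mul1mx -mulmxA QQ' mulmx1.
clearbody G'.
have G'0 i : G' i 0 = x *+ (i == 0).
  have /colP/(_ i) := G'e; rewrite -colE !mxE => ->.
  by rewrite eqxx andbT mulr_natr.
have dl : dlsubmx G' = 0.
  apply/matrixP => i j; rewrite !mxE ord1.
  rewrite (_ : lshift p 0 = 0); last exact/val_inj.
  by rewrite G'0.
have ur : ursubmx G' = 0 by rewrite -[LHS]trmxK trmx_ursub G'sym dl trmx0.
have ul : ulsubmx G' = x%:M.
  apply/matrixP => i j; rewrite !mxE !ord1.
  by rewrite (_ : lshift p 0 = 0) ?G'0 ?eqxx //; exact/val_inj.
have [|V [d [VV dE]]] := IHp (drsubmx G'); first by rewrite trmx_drsub G'sym.
pose V' : 'M[R]_(1 + p) := block_mx 1%:M 0 0 V.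
have V'V' : orthogonal_mx V'.
  rewrite /orthogonal_mx tr_block_mx mulmx_block !trmx0 trmx1 !mulmx0 !mul0mx.
  by rewrite mulmx1 !addr0 add0r VV -scalar_mx_block.
have G'E : G' = V' *m diag_mx (row_mx x%:M d) *m V'^T.
  rewrite -[G']submxK ul ur dl dE diag_mx_row tr_block_mx !mulmx_block.
  rewrite !trmx0 trmx1 !(mulmx0, mul0mx, addr0, add0r, mul1mx, mulmx1).
  congr block_mx; apply/matrixP => i j; rewrite !ord1 !mxE.
  by rewrite eqxx !mulr1n.
exists (Q *m V'), (row_mx x%:M d); split; first exact: orthogonal_mxM.
by rewrite GE G'E trmx_mul !mulmxA.
Qed.

Lemma char_poly_orthogonal_diag (R : realType) p (V : 'M[R]_p) (d : 'rV[R]_p) :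
  orthogonal_mx V ->
  char_poly (V *m diag_mx d *m V^T) = \prod_i ('X - (d 0 i)%:P).
Proof.
move=> VV; have VV' := orthogonal_mxC VV.
(* Similar matrices have the same characteristic polynomial. *)
transitivity (char_poly (diag_mx d)); last first.
  rewrite char_poly_trig ?diag_mx_is_trig //.
  by apply: eq_bigr => i _; rewrite mxE eqxx mulr1n.
rewrite /char_poly /char_poly_mx.
pose W := map_mx polyC V; pose W' := map_mx polyC V^T.
have WW' : W *m W' = 1%:M by rewrite -map_mxM VV' map_mx1.
have -> : 'X%:M - map_mx polyC (V *m diag_mx d *m V^T) =
    W *m ('X%:M - map_mx polyC (diag_mx d)) *m W'.
  rewrite !map_mxM mulmxBr mulmxBl; congr (_ - _).
  by rewrite mul_mx_scalar -scalemxAl WW' scalemx1.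
by rewrite !det_mulmx mulrAC -det_mulmx WW' det1 mul1r.
Qed.

Lemma sqnorm_diag (R : realType) p (d : 'rV[R]_p) (y : 'cV[R]_p) :
  (y^T *m diag_mx d *m y) 0 0 = \sum_i d 0 i * y i 0 ^+ 2.
Proof.
rewrite -mulmxA mxE; apply: eq_bigr => i _.
by rewrite mul_diag_mx !mxE; ring.
Qed.

(** The diagonal entries of an orthogonal diagonalization and [eigenvalue_seq]
    are two factorizations of the characteristic polynomial into linear
    factors, so they agree up to a permutation, which is then applied to the
    columns of the diagonalizing matrix. *)
Lemma symmetric_eigenvalue_seq (R : realType) p (G : 'M[R]_p) :
  G^T = G ->
  [/\ size (eigenvalue_seq G) = p,
      sorted (fun x y : R => y <= x) (eigenvalue_seq G)
    & exists2 V : 'M[R]_p, orthogonal_mx V &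
        G = V *m diag_mx (\row_i (eigenvalue_seq G)`_i) *m V^T].
Proof.
move=> /symmetric_orthogonal_diag[V [d [VV GE]]].
have cG := char_poly_orthogonal_diag d VV; rewrite -GE in cG.
pose t := [tuple d 0 i | i < p].
have cGt : char_poly G = \prod_(x <- t) ('X - x%:P).
  by rewrite cG big_image.
have [] : [set s : seq R | sorted (fun x y : R => y <= x) s /\
    char_poly G = \prod_(x <- s) ('X - x%:P)]%classic (eigenvalue_seq G).
  apply: (@xgetPex _ [::]); exists (sort (fun x y : R => y <= x) t); split.
    by apply: sort_sorted => x y; exact: ge_total.
  by rewrite cGt; apply/perm_big; rewrite perm_sym perm_sort.
move=> sG; rewrite cGt => /prod_XsubC_eq; rewrite perm_sym => st.
split => //; first by rewrite (perm_size st) size_tuple.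
have /tuple_permP[s sE] := st.
have nthE (i : 'I_p) : (eigenvalue_seq G)`_i = d 0 (s i).
  by rewrite sE -tnth_nth !tnth_mktuple.
exists (col_perm s V).
  apply/matrixP => i j; rewrite mxE.
  have /matrixP/(_ (s i) (s j)) := VV; rewrite !mxE (inj_eq perm_inj) => <-.
  by apply: eq_bigr => k _; rewrite !mxE.
apply/matrixP => i j; rewrite {1}GE !mxE (reindex_inj (@perm_inj _ s)).
by apply: eq_bigr => k _; rewrite !mul_mx_diag !mxE nthE.
Qed.

(** * Singular values *)

Lemma gram_sym (R : realType) p q (X : 'M[R]_(p, q)) : (X^T *m X)^T = X^T *m X.
Proof. by rewrite trmx_mul trmxK. Qed.

(** The i-th eigenvalue of X^T X is the squared norm of the image under X of the
    corresponding unit eigenvector. *)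
Lemma gram_eigenvalue_ge0 (R : realType) p q (X : 'M[R]_(p, q)) i :
  0 <= (eigenvalue_seq (X^T *m X))`_i.
Proof.
have [sz _ [V VV]] := symmetric_eigenvalue_seq (gram_sym X).
set s := eigenvalue_seq _ => GE; rewrite -/s in sz.
have [iq|qi] := ltnP i q; last by rewrite nth_default ?sz.
have -> : s`_i = sqnorm (X *m (V *m delta_mx (Ordinal iq) 0)).
  rewrite sqnormE !trmx_mul !mulmxA -(mulmxA _ X^T) GE !mulmxA.
  rewrite -(mulmxA _ V^T V) VV mulmx1 -(mulmxA _ V^T V) VV mulmx1.
  rewrite sqnorm_diag (bigD1 (Ordinal iq)) //= big1 ?addr0 => [|j ji].
    by rewrite !mxE !eqxx expr1n mulr1.
  by rewrite !mxE (negPf ji) expr0n mulr0.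
exact: sqnorm_ge0.
Qed.

Lemma sigma_ge0 (R : realType) j p q (X : 'M[R]_(p, q)) : 0 <= sigma j X.
Proof. exact: sqrtr_ge0. Qed.

Lemma sigma_sqr (R : realType) j p q (X : 'M[R]_(p, q)) :
  sigma j X ^+ 2 = (eigenvalue_seq (X^T *m X))`_j.-1.
Proof. by rewrite sqr_sqrtr ?gram_eigenvalue_ge0. Qed.

Lemma le_sigma (R : realType) i j p q (X : 'M[R]_(p, q)) :
  (i <= j)%N -> sigma j X <= sigma i X.
Proof.
move=> ij; apply: ler_wsqrtr.
have [sz so _] := symmetric_eigenvalue_seq (gram_sym X).
have [jq|qj] := ltnP j.-1 q; last first.
  by rewrite [leLHS]nth_default ?sz // gram_eigenvalue_ge0.
have i1j1 : (i.-1 <= j.-1)%N by rewrite -!subn1 leq_sub2r.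
apply: (@sorted_leq_nth _ (fun x y : R => y <= x)) => //; rewrite ?inE ?sz //.
- by move=> x y z yx zx; apply: le_trans zx yx.
- exact: leq_ltn_trans jq.
Qed.

(** The columns of V are the right singular vectors of X. *)
Lemma singular_basis (R : realType) p q (X : 'M[R]_(p, q)) :
  exists2 V : 'M[R]_q, orthogonal_mx V &
    forall y, sqnorm (X *m (V *m y)) = \sum_(i < q) sigma i.+1 X ^+ 2 * y i 0 ^+ 2.
Proof.
have [_ _ [V VV GE]] := symmetric_eigenvalue_seq (gram_sym X).
exists V => // y.
rewrite sqnormE !trmx_mul !mulmxA -(mulmxA _ X^T) GE !mulmxA.
rewrite -(mulmxA _ V^T V) VV mulmx1 -(mulmxA _ V^T V) VV mulmx1.
by rewrite sqnorm_diag; apply: eq_bigr => i _; rewrite sigma_sqr mxE.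
Qed.

Lemma sqnorm_mulmx_norm2 (R : realType) p q (X : 'M[R]_(p, q)) u :
  sqnorm (X *m u) <= norm2 X ^+ 2 * sqnorm u.
Proof.
have [V VV XV] := singular_basis X.
have -> : u = V *m (V^T *m u) by rewrite mulmxA orthogonal_mxC // mul1mx.
rewrite XV sqnorm_isometry // /sqnorm mulr_sumr; apply: ler_sum => i _.
rewrite ler_wpM2r ?sqr_ge0 // ler_sqr ?nnegrE ?sigma_ge0 //.
exact: le_sigma.
Qed.

Lemma kernel_vector (R : realType) p q (B : 'M[R]_(p, q)) :
  (\rank B < q)%N -> exists2 u : 'cV[R]_q, u != 0 & B *m u = 0.
Proof.
rewrite -mxrank_tr => rB.
have : kermx B^T != 0 by rewrite kermx_eq0 /row_free neq_ltn rB.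
move=> /rowV0Pn[v /sub_kermxP vB v0]; exists v^T; first by rewrite trmx_eq0.
by apply: trmx_inj; rewrite trmx_mul trmxK vB trmx0.
Qed.

Lemma pid_mx_mul_in (R : realType) p q (y : 'cV[R]_q) (i : 'I_p) (k : 'I_q) :
  i = k :> nat -> ((pid_mx p : 'M[R]_(p, q)) *m y) i 0 = y k 0.
Proof.
move=> ik; rewrite mxE (bigD1 k) //= big1 ?addr0 => [|j jk].
  by rewrite mxE ik eqxx -ik ltn_ord mul1r.
have kj : (k == j :> nat) = false by rewrite eq_sym; apply/negbTE.
by rewrite mxE ik kj mul0r.
Qed.

Lemma pid_mx_mul_out (R : realType) p q (y : 'cV[R]_q) (i : 'I_p) :
  (q <= i)%N -> ((pid_mx q : 'M[R]_(p, q)) *m y) i 0 = 0.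
Proof. by move=> qi; rewrite mxE big1 // => j _; rewrite mxE ltnNge qi andbF mul0r. Qed.

(** In the basis of right singular vectors, j - 1 linear conditions on the j
    coordinates of u remove the components of W u along the first j - 1
    singular vectors; on what remains X stretches lengths by at most
    sigma_j(X). *)
Lemma sigma_ge (R : realType) p q j (X : 'M[R]_(p, q)) (W : 'M[R]_(q, j)) (c : R) :
  (0 < j)%N -> W^T *m W = 1%:M ->
  (forall u, c * sqnorm u <= sqnorm (X *m (W *m u))) -> c <= sigma j X ^+ 2.
Proof.
move=> j0 WW cW; have [V VV XV] := singular_basis X.
pose B : 'M[R]_(j.-1, j) := pid_mx j.-1 *m (V^T *m W).
have [|u u0 Bu] := @kernel_vector _ _ _ B.
  by apply: leq_ltn_trans (rank_leq_row _) _; rewrite prednK.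
pose y := V^T *m (W *m u).
have Wu : W *m u = V *m y by rewrite /y mulmxA orthogonal_mxC // mul1mx.
have uy : sqnorm u = sqnorm y by rewrite -(sqnorm_isometry u WW) Wu sqnorm_isometry.
have y0 (i : 'I_q) : (i < j.-1)%N -> y i 0 = 0.
  move=> ij; rewrite -(@pid_mx_mul_in _ _ _ y (Ordinal ij)) //.
  by rewrite /y !mulmxA -(mulmxA (pid_mx _)) -/B Bu mxE.
rewrite -(ler_pM2r (sqnorm_gt0 u0)); apply: le_trans (cW u) _.
rewrite Wu XV uy /sqnorm mulr_sumr; apply: ler_sum => i _.
have [ij|ji] := ltnP i j.-1; first by rewrite y0 // expr0n !mulr0.
rewrite ler_wpM2r ?sqr_ge0 // ler_sqr ?nnegrE ?sigma_ge0 //.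
by apply: le_sigma; rewrite -(prednK j0).
Qed.

(** The columns of W are the first j right singular vectors. *)
Lemma sigma_witness (R : realType) p q j (X : 'M[R]_(p, q)) :
  (j <= q)%N ->
  exists2 W : 'M[R]_(q, j), W^T *m W = 1%:M &
    forall u, sigma j X ^+ 2 * sqnorm u <= sqnorm (X *m (W *m u)).
Proof.
move=> jq; have [V VV XV] := singular_basis X.
have PP : (pid_mx j : 'M[R]_(q, j))^T *m pid_mx j = 1%:M.
  by rewrite tr_pid_mx mul_pid_mx minnn (minn_idPr jq) pid_mx_1.
exists (V *m pid_mx j) => [|u].
  by rewrite trmx_mul -mulmxA (mulmxA V^T) VV mul1mx.
rewrite -(sqnorm_isometry u PP) -mulmxA XV /sqnorm mulr_sumr.
apply: ler_sum => i _; have [ij|ji] := ltnP i j; last first.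
  by rewrite pid_mx_mul_out // expr0n !mulr0.
rewrite ler_wpM2r ?sqr_ge0 // ler_sqr ?nnegrE ?sigma_ge0 //.
exact: le_sigma.
Qed.

Lemma norm2_le (R : realType) p q (X : 'M[R]_(p, q)) (c : R) :
  0 <= c -> (forall u, sqnorm (X *m u) <= c * sqnorm u) -> norm2 X ^+ 2 <= c.
Proof.
move=> c0 Xc; have [q0|q0] := posnP q.
  have [sz _ _] := symmetric_eigenvalue_seq (gram_sym X).
  by rewrite /norm2 sigma_sqr nth_default // sz q0.
have [W WW XW] := @sigma_witness R p q 1 X q0.
have u0 : (1 : 'cV[R]_1) != 0 by exact: oner_neq0.
rewrite -(ler_pM2r (sqnorm_gt0 u0)); apply: le_trans (XW _) _.
by apply: le_trans (Xc _) _; rewrite sqnorm_isometry.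
Qed.

(** Transport to Y the optimal j-dimensional subspace for X. The orthogonal P and
    the constant c, which may be 0, make this one statement cover invariance
    under orthogonal changes of basis, monotonicity and additive perturbation. *)
Lemma sigma_perturb (R : realType) p r q j (X : 'M[R]_(p, q)) (Y : 'M[R]_(r, q))
    (P : 'M[R]_q) (c : R) :
  orthogonal_mx P -> (0 < j <= q)%N ->
  (forall u, sqnorm (X *m u) <= sqnorm (Y *m (P *m u)) + c * sqnorm u) ->
  sigma j X ^+ 2 <= sigma j Y ^+ 2 + c.
Proof.
move=> PP /andP[j0 jq] XY; have [W WW XW] := sigma_witness X jq.
rewrite -lerBlDr; apply: (@sigma_ge _ _ _ _ _ (P *m W)) => // [|u].
  by rewrite trmx_mul -mulmxA (mulmxA P^T) PP mul1mx.
rewrite mulrBl lerBlDr; apply: le_trans (XW u) (le_trans (XY _) _).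
by rewrite (sqnorm_isometry u WW) -(mulmxA P W).
Qed.



Lemma orthogonal_mx1 (R : realType) p : orthogonal_mx (1%:M : 'M[R]_p).
Proof. by rewrite /orthogonal_mx trmx1 mulmx1. Qed.

Lemma orthogonal_mx_tr (R : realType) p (P : 'M[R]_p) :
  orthogonal_mx P -> orthogonal_mx P^T.
Proof. by move=> PP; rewrite /orthogonal_mx trmxK orthogonal_mxC. Qed.

Lemma sigma_mul_orthogonal (R : realType) j p q (X : 'M[R]_(p, q))
    (Q : 'M[R]_p) (P : 'M[R]_q) :
  orthogonal_mx Q -> orthogonal_mx P -> (0 < j <= q)%N ->
  sigma j (Q *m X *m P) = sigma j X.
Proof.
move=> QQ PP jq; apply/eqP; rewrite eq_le.
apply/andP; split; rewrite -ler_sqr ?nnegrE ?sigma_ge0 // -[leRHS]addr0.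
  apply: (sigma_perturb PP) => // u.
  by rewrite mul0r addr0 -!mulmxA sqnorm_isometry.
apply: (sigma_perturb (orthogonal_mx_tr PP)) => // u.
rewrite mul0r addr0 -!mulmxA (mulmxA P P^T) orthogonal_mxC // mul1mx.
by rewrite [leRHS]sqnorm_isometry.
Qed.

(** The restriction of X to the range of W stretches lengths at least as much as
    B does, hence at least by the inverse of the Frobenius norm of B^-1, and
    this norm is at most sqrt r times the largest row norm of B^-1. *)
Lemma sigma_ge_inverse (R : realType) p q r (X : 'M[R]_(p, q)) (W : 'M[R]_(q, r))
    (B : 'M[R]_r) :
  (0 < r)%N -> W^T *m W = 1%:M -> B \in unitmx ->
  (forall u, sqnorm (B *m u) <= sqnorm (X *m (W *m u))) ->
  1 <= r%:R * norm12 (invmx B)^T ^+ 2 * sigma r X ^+ 2.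
Proof.
move=> r0 WW uB BX; set h := r%:R * _.
have hB u : sqnorm u <= h * sqnorm (B *m u).
  by rewrite -{1}[u](mulKmx uB) sqnorm_mulmx_norm12_tr.
have h0 : 0 < h.
  rewrite lt_def mulr_ge0 ?sqr_ge0 // andbT; apply/eqP => h0.
  have u0 : (const_mx 1 : 'cV[R]_r) != 0.
    by apply/eqP => /colP/(_ (Ordinal r0)); rewrite !mxE; apply/eqP/oner_neq0.
  by have := hB (const_mx 1); rewrite h0 mul0r leNgt sqnorm_gt0.
rewrite -ler_pdivrMl // mulr1; apply: (sigma_ge r0 WW) => u.
by rewrite ler_pdivrMl //; apply: le_trans (hB u) _; rewrite ler_pM2l.
Qed.

(** * Truncated singular value decompositions *)

Lemma sum_ord_eq (R : realType) p k (F : 'I_p -> R) :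
  \sum_(i < p | k == i :> nat) F i = if insub k is Some i then F i else 0.
Proof.
case: insubP => [i _ ik|]; last first.
  rewrite -leqNgt => pk; rewrite big_pred0 // => i.
  by rewrite gtn_eqF // (leq_trans _ pk).
by rewrite (big_pred1 i) // => j; rewrite -ik eq_sym.
Qed.

(** Each row of a rectangular diagonal matrix has at most one nonzero entry, and
    so has each column: the coordinates of the image are distinct coordinates of
    y, scaled, together with zeros. *)
Lemma sqnorm_rect_diag (R : realType) p q (s : nat -> R) (c : R) (y : 'cV[R]_q) :
  0 <= c -> (forall i, s i ^+ 2 <= c) ->
  sqnorm (rect_diag_mx p q s *m y) <= c * sqnorm y.
Proof.
move=> c0 sc.
have le_row (i : 'I_p) : (rect_diag_mx p q s *m y) i 0 ^+ 2 <=
    \sum_(j < q | i == j :> nat) c * y j 0 ^+ 2.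
  have -> : (rect_diag_mx p q s *m y) i 0 =
      \sum_(j < q | i == j :> nat) s i * y j 0.
    rewrite mxE [RHS]big_mkcond; apply: eq_bigr => j _; rewrite mxE.
    by case: ifP; rewrite ?mul0r.
  rewrite !sum_ord_eq; case: insubP => [j _ _|_]; last by rewrite expr0n.
  by rewrite exprMn ler_wpM2r ?sqr_ge0.
apply: le_trans (ler_sum _ (fun i _ => le_row i)) _.
rewrite (exchange_big_dep xpredT) //= mulr_sumr; apply: ler_sum => j _.
under eq_bigl do rewrite eq_sym.
rewrite sum_ord_eq; case: insubP => // _.
by rewrite mulr_ge0 ?sqr_ge0.
Qed.

(** In the bases of the decomposition, X - Y is diagonal with entries 0 and the
    singular values of X from the (k+1)-st on. *)
Lemma truncated_svd_error (R : realType) k p q (X Y : 'M[R]_(p, q)) u :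
  truncated_svd k X Y ->
  sqnorm ((X - Y) *m u) <= sigma k.+1 X ^+ 2 * sqnorm u.
Proof.
case=> U [V [UU VV XE ->]]; rewrite [X in X - _]XE -mulmxBl -mulmxBr.
set D := rect_diag_mx _ _ _ - _.
have -> : D = rect_diag_mx p q (fun i => if (i < k)%N then 0 else sigma i.+1 X).
  apply/matrixP => i j; rewrite !mxE.
  by case: ((i : nat) == j); case: (i < k)%N; rewrite ?subrr ?subr0.
rewrite -!mulmxA sqnorm_isometry //.
rewrite -(sqnorm_isometry u (orthogonal_mx_tr VV)).
apply: sqnorm_rect_diag => [|i]; first exact: sqr_ge0.
case: ltnP => [_|ki]; first by rewrite expr0n sqr_ge0.
by rewrite ler_sqr ?nnegrE ?sigma_ge0 //; apply: le_sigma.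
Qed.

(** * Partial QR factorizations *)

Lemma perm_mx_orthogonal (R : realType) p (P : 'M[R]_p) :
  is_perm_mx P -> orthogonal_mx P.
Proof.
move=> /is_perm_mxP[s ->].
by rewrite /orthogonal_mx tr_perm_mx -perm_mxM fingroup.mulVg perm_mx1.
Qed.

Lemma sigma_castmx (R : realType) j p q p' q' (e : (p = p') * (q = q'))
    (X : 'M[R]_(p, q)) : sigma j (castmx e X) = sigma j X.
Proof. by case: e => ep eq; case: p' / ep; case: q' / eq; rewrite castmx_id. Qed.

Lemma castmx_sub (R : realType) p q p' q' (e : (p = p') * (q = q'))
    (X Y : 'M[R]_(p, q)) : castmx e X - castmx e Y = castmx e (X - Y).
Proof. by case: e => ep eq; case: p' / ep; case: q' / eq; rewrite !castmx_id. Qed.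

Lemma sqnorm_partial_qr (R : realType) (l p q : nat) (R22 : 'M[R]_(p, q))
    (Y : 'M[R]_(l, l + q)) (u : 'cV[R]_(l + q)) :
  sqnorm (col_mx Y (row_mx 0 R22) *m u) <=
  sqnorm (Y *m u) + norm2 R22 ^+ 2 * sqnorm u.
Proof.
rewrite mul_col_mx sqnorm_col_mx lerD2l -[u]vsubmxK mul_row_col mul0mx add0r.
apply: le_trans (sqnorm_mulmx_norm2 _ _) _; rewrite ler_wpM2l ?sqr_ge0 //.
by rewrite sqnorm_col_mx lerDr sqnorm_ge0.
Qed.

Lemma sigma_partial_qr_le (R : realType) (l p q : nat) (R11 : 'M[R]_l)
    (R12 : 'M[R]_(l, q)) (R22 : 'M[R]_(p, q)) j : (0 < j <= l + q)%N ->
  sigma j (block_mx R11 R12 0 R22) ^+ 2 <=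
  sigma j (row_mx R11 R12) ^+ 2 + norm2 R22 ^+ 2.
Proof.
move=> jq; apply: (sigma_perturb (@orthogonal_mx1 R _)) => // u.
by rewrite mul1mx; exact: sqnorm_partial_qr.
Qed.

Lemma sigma_row_block_le (R : realType) (l p q : nat) (R11 : 'M[R]_l)
    (R12 : 'M[R]_(l, q)) (R22 : 'M[R]_(p, q)) j :
  (0 < j <= l + q)%N ->
  sigma j (row_mx R11 R12) <= sigma j (block_mx R11 R12 0 R22).
Proof.
move=> jq; rewrite -ler_sqr ?nnegrE ?sigma_ge0 // -[leRHS]addr0.
apply: (sigma_perturb (@orthogonal_mx1 R _)) => // u.
by rewrite mul1mx mul0r addr0 [in leRHS]mul_col_mx sqnorm_col_mx lerDl sqnorm_ge0.
Qed.

Lemma truncation_error_le (R : realType) (l p q : nat) (R11 : 'M[R]_l)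
    (R12 : 'M[R]_(l, q)) (R22 : 'M[R]_(p, q)) k
    (Y : 'M[R]_(l, l + q)) :
  truncated_svd k (row_mx R11 R12) Y ->
  norm2 (block_mx R11 R12 0 R22 - col_mx Y 0) ^+ 2 <=
  sigma k.+1 (row_mx R11 R12) ^+ 2 + norm2 R22 ^+ 2.
Proof.
move=> tY; apply: norm2_le => [|u]; first by rewrite addr_ge0 ?sqr_ge0.
have -> : block_mx R11 R12 0 R22 - col_mx Y 0 =
    col_mx (row_mx R11 R12 - Y) (row_mx 0 R22).
  by rewrite /block_mx opp_col_mx add_col_mx subr0.
apply: le_trans (sqnorm_partial_qr _ _ _) _.
by rewrite mulrDl lerD2r truncated_svd_error.
Qed.

Lemma sigma_row_block_ge (R : realType) (l q : nat) (R11 : 'M[R]_l)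
    (R12 : 'M[R]_(l, q)) : (0 < l)%N -> R11 \in unitmx ->
  1 <= l%:R * norm12 (invmx R11)^T ^+ 2 * sigma l (row_mx R11 R12) ^+ 2.
Proof.
move=> l0 uR; apply: (@sigma_ge_inverse _ _ _ _ _ (col_mx 1%:M 0)) => // [|u].
  by rewrite tr_col_mx mul_row_col trmx1 mulmx1 mulmx0 addr0.
by rewrite mulmxA mul_row_col mulmx1 mulmx0 addr0.
Qed.

(** The column that the reflection sends to alpha e_1 has norm |alpha|. When R22
    has no row, there is no first entry to hold alpha, hence 0 < p. *)
Lemma qr_pivot_stepP (R : realType) (l p q : nat) (R12 : 'M[R]_(l, q))
    (R22 : 'M[R]_(p, q)) (a : 'cV[R]_l) (alpha : R) :
  (0 < p)%N -> qr_pivot_step R12 R22 a alpha ->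
  exists j, a = col j R12 /\ sqnorm (col j R22) = alpha ^+ 2.
Proof.
move=> p0 [j0 [j [H [j00 _ /householder_orthogonal HH Hc ->]]]]; exists j.
have xcolE r (X : 'M[R]_(r, q)) : col j0 (xcol j0 j X) = col j X.
  by apply/colP => i; rewrite !mxE tpermL.
split=> //; rewrite -(sqnorm_isometry _ HH) -(xcolE _ R22) !colE mulmxA -colE Hc.
rewrite /sqnorm (bigD1 (Ordinal p0)) //= big1 => [|i i0]; first by rewrite mxE addr0.
by rewrite mxE (negPf (i0 : (i : nat) != 0%N)) expr0n.
Qed.

(** W selects the first l columns and the pivot column of the block matrix; by
    [qr_pivot_stepP] the selected columns have the same Gram matrix as Rh. *)
Lemma sigma_pivot_ge (R : realType) (l p q : nat) (R11 : 'M[R]_l)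
    (R12 : 'M[R]_(l, q)) (R22 : 'M[R]_(p, q)) (a : 'cV[R]_l) (alpha : R)
    (Rh := block_mx R11 a 0 alpha%:M) :
  (0 < p)%N -> qr_pivot_step R12 R22 a alpha -> alpha != 0 -> R11 \in unitmx ->
  1 <= l.+1%:R * norm12 (invmx Rh)^T ^+ 2 * sigma l.+1 (block_mx R11 R12 0 R22) ^+ 2.
Proof.
move=> p0 /(qr_pivot_stepP p0)[j [aj aE]] alpha0 uR11; rewrite -addn1.
pose W : 'M[R]_(l + q, l + 1) := block_mx 1%:M 0 0 (delta_mx j 0).
apply: (@sigma_ge_inverse _ _ _ _ _ W) => [||| u]; first by rewrite addn1.
- rewrite /W tr_block_mx mulmx_block trmx1 !trmx0 !(mulmx0, mul0mx, addr0, add0r).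
  rewrite mulmx1 trmx_delta mul_delta_mx scalar_mx_block.
  by congr block_mx; apply/matrixP => i i'; rewrite !mxE !ord1.
- rewrite unitmxE /Rh det_ublock unitrM -unitmxE uR11 det_scalar1.
  by rewrite unitfE.
rewrite -[u]vsubmxK /W /Rh !mul_block_col !mul0mx mul1mx addr0 !add0r.
rewrite !mulmxA -!colE -aj mul_scalar_mx !sqnorm_col_mx lerD2l.
by rewrite [dsubmx u]mx11_scalar mul_mx_scalar !sqnormZ aE mulrC
  /sqnorm big_ord1 mxE eqxx.
Qed.

Lemma norm12_pivot_gt0 (R : realType) (l p q : nat) (R12 : 'M[R]_(l, q))
    (R22 : 'M[R]_(p, q)) (a : 'cV[R]_l) (alpha : R) :
  (0 < p)%N -> qr_pivot_step R12 R22 a alpha -> alpha != 0 -> 0 < norm12 R22.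
Proof.
move=> p0 /(qr_pivot_stepP p0)[j [_ aE]] alpha0.
rewrite lt_def norm12_ge0 andbT; apply/eqP => N0.
have := sqnorm_col_le R22 j; rewrite N0 expr0n leNgt.
suff -> : \sum_i R22 i j ^+ 2 = alpha ^+ 2 by rewrite lt_def sqrf_eq0 alpha0 sqr_ge0.
by rewrite -aE; apply: eq_bigr => i _; rewrite mxE.
Qed.


(** * The error bounds *)

(** The inverse of R11 is the upper left block of the inverse of the bordered
    matrix, so its rows are truncations of rows of the latter. *)
Lemma norm12_pivot_inv_ge (R : realType) l (R11 : 'M[R]_l) (a : 'cV[R]_l) (alpha : R) :
  R11 \in unitmx -> alpha != 0 ->
  norm12 (invmx R11)^T <= norm12 (invmx (block_mx R11 a 0 alpha%:M))^T.
Proof.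
move=> uR alpha0.
pose B := block_mx (invmx R11) (- (alpha^-1 *: (invmx R11 *m a))) 0 (alpha^-1)%:M.
have BR : B *m block_mx R11 a 0 alpha%:M = 1%:M.
  rewrite mulmx_block !(mulmx0, mul0mx, addr0, add0r) mulVmx // mulNmx.
  rewrite mul_mx_scalar scalerA divff // scale1r subrr.
  by rewrite -scalar_mxM mulVf // -scalar_mx_block.
have [_ uRh] := mulmx1_unit BR.
by rewrite -[invmx (block_mx _ _ _ _)]mul1mx -BR mulmxK // norm12_tr_block_ge.
Qed.

(** Here a, r, S, s stand for sigma_j(A), sigma_j(Rt), |R22|, sigma_(l+1)(A), and
    b, t for taub, tau. The hypothesis on b turns a^2 <= r^2 + S^2 into
    a^2 <= r^2 (1 + b^2). For the other term of the minimum, t^2 s^2 = S^2, and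
    the inequality just obtained gives S^2 <= r^2 S^2 (1 + b^2) / a^2. *)
Lemma sigma_lower_bound_scalar (R : realType) (a r S b t s : R) :
  0 < a -> 0 < r -> 0 < s -> 0 <= S -> t = S / s ->
  a ^+ 2 <= r ^+ 2 + S ^+ 2 -> S / r <= b ->
  a / Num.sqrt (1 + Num.min (b ^+ 2) (t ^+ 2 * (1 + b ^+ 2) * (s / a) ^+ 2)) <= r.
Proof.
move=> a0 r0 s0 S0 -> aS; rewrite ler_pdivrMr // => Srb.
have b0 : 0 <= b by rewrite -(pmulr_lge0 _ r0) (le_trans S0).
have Sb : S ^+ 2 <= r ^+ 2 * b ^+ 2.
  by rewrite -exprMn ler_sqr ?nnegrE ?mulr_ge0 ?(ltW r0) // mulrC.
have ab : a ^+ 2 <= r ^+ 2 * (1 + b ^+ 2) by lra.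
have -> : (S / s) ^+ 2 * (1 + b ^+ 2) * (s / a) ^+ 2 = S ^+ 2 * (1 + b ^+ 2) / a ^+ 2.
  by field; rewrite !gt_eqF.
set c := S ^+ 2 * _ / _.
have cE : c * a ^+ 2 = S ^+ 2 * (1 + b ^+ 2) by rewrite divfK // expf_neq0 // gt_eqF.
have a20 : 0 < a ^+ 2 by rewrite exprn_gt0.
have Sc : S ^+ 2 <= r ^+ 2 * c.
  rewrite -(ler_pM2r a20) -(mulrA (r ^+ 2) c) cE.
  by have := ler_wpM2l (sqr_ge0 S) ab; lra.
have c0 : 0 <= c by rewrite divr_ge0 ?sqr_ge0 // mulr_ge0 ?addr_ge0 ?sqr_ge0.
have m0 : 0 < 1 + Num.min (b ^+ 2) c by rewrite ltr_pwDl // le_min sqr_ge0.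
rewrite ler_pdivrMr ?sqrtr_gt0 //.
rewrite -ler_sqr ?nnegrE ?mulr_ge0 ?sqrtr_ge0 ?(ltW a0) ?(ltW r0) //.
rewrite exprMn sqr_sqrtr ?(ltW m0) //.
by rewrite /Num.min; case: ifP => _ //; lra.
Qed.

(** With g the largest row norm of an inverse and s a singular value, the last
    hypothesis has the form that [sigma_ge_inverse] provides. *)
Lemma ratio_le_sqrt (R : realType) (S N s g : R) (d q : nat) :
  0 < s -> 0 <= S -> 0 <= N -> 0 <= g -> S ^+ 2 <= q%:R * N ^+ 2 ->
  1 <= d%:R * g ^+ 2 * s ^+ 2 ->
  S / s <= N * g * Num.sqrt (d * q)%:R.
Proof.
move=> s0 S0 N0 g0 SN gs; rewrite ler_pdivrMr //.
rewrite -ler_sqr ?nnegrE ?mulr_ge0 ?sqrtr_ge0 ?(ltW s0) // !exprMn sqr_sqrtr ?ler0n //.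
apply: le_trans SN _; rewrite natrM.
have -> : N ^+ 2 * g ^+ 2 * (d%:R * q%:R) * s ^+ 2 =
  (q%:R * N ^+ 2) * (d%:R * g ^+ 2 * s ^+ 2) by ring.
by rewrite ler_peMr // mulr_ge0 ?sqr_ge0.
Qed.

Theorem mainTheorem2 (R : realType) (m n k l : nat)
  (hk : (1 <= k)%N) (hkl : (k <= l)%N) (hlm : (l < m)%N) (hln : (l < n)%N)
  (A : 'M[R]_(m, n)) (Pi : 'M[R]_n) (Q : 'M[R]_m)
  (R11 : 'M[R]_l) (R12 : 'M[R]_(l, n - l)) (R22 : 'M[R]_(m - l, n - l))
  (hPi : is_perm_mx Pi) (hQ : orthogonal_mx Q)
  (hR11_upper : is_trig_mx R11^T) (hR11_unit : R11 \in unitmx)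
  (hA : A *m Pi = Q *m blocks_mx hlm hln (block_mx R11 R12 0 R22))
  (Rt_k : 'M[R]_(l, l + (n - l)))
  (hRt_k : truncated_svd k (row_mx R11 R12) Rt_k)
  (a : 'cV[R]_l) (alpha : R)
  (hstep : qr_pivot_step R12 R22 a alpha) (halpha : alpha != 0) :
  let Rt : 'M[R]_(l, l + (n - l)) := row_mx R11 R12 in
  let Rh : 'M[R]_(l + 1) := block_mx R11 a 0 alpha%:M in
  let g1 := norm12 R22 / `|alpha| in
  let g2 := `|alpha| * norm12 (invmx Rh)^T in
  let tau := g1 * g2 * (norm2 R22 / norm12 R22) *
             ((norm12 (invmx Rh)^T)^-1 / sigma l.+1 A) in
  let tauh := g1 * g2 * (norm2 R22 / norm12 R22) *
              ((norm12 (invmx R11)^T)^-1 / sigma l Rt) in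
  let taub := tauh * (sigma l Rt / sigma k Rt) in
  [/\ tau <= g1 * g2 * Num.sqrt (l.+1 * (n - l))%:R,
      tauh <= g1 * g2 * Num.sqrt (l * (n - l))%:R,
      forall j : nat, (1 <= j)%N -> (j <= k)%N ->
        sigma j Rt >=
          sigma j A /
          Num.sqrt (1 + Num.min (taub ^+ 2)
            (tau ^+ 2 * (1 + taub ^+ 2) * (sigma l.+1 A / sigma j A) ^+ 2))
    & norm2 (A *m Pi - Q *m blocks_mx hlm hln (col_mx Rt_k 0)) <=
        sigma k.+1 A *
        Num.sqrt (1 + tau ^+ 2 * (sigma l.+1 A / sigma k.+1 A) ^+ 2)].
Proof.
move=> Rt Rh g1 g2 tau tauh taub.
have p0 : (0 < m - l)%N by rewrite subn_gt0.
have l0 : (0 < l)%N by apply: leq_trans hkl.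
have nE : (l + (n - l))%N = n by rewrite subnKC // ltnW.
set M := block_mx R11 R12 0 R22 in hA.
have sigmaA j : (0 < j <= n)%N -> sigma j A = sigma j M.
  move=> jn; have PP := perm_mx_orthogonal hPi.
  have -> : A = Q *m blocks_mx hlm hln M *m Pi^T.
    by rewrite -hA -mulmxA orthogonal_mxC // mulmx1.
  by rewrite sigma_mul_orthogonal ?sigma_castmx //; exact: orthogonal_mx_tr.
have sAl : sigma l.+1 A = sigma l.+1 M by rewrite sigmaA.
have N0 : 0 < norm12 R22 := norm12_pivot_gt0 p0 hstep halpha.
have S0 : 0 <= norm2 R22 := sigma_ge0 _ _.
have SN : norm2 R22 ^+ 2 <= (n - l)%:R * norm12 R22 ^+ 2.
  apply: norm2_le => [|u]; first by rewrite mulr_ge0 ?sqr_ge0.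
  exact: sqnorm_mulmx_norm12.
have al0 : `|alpha| != 0 by rewrite normr_eq0.
have Rh_bound := sigma_pivot_ge p0 hstep halpha hR11_unit.
rewrite -/Rh -/M -sAl in Rh_bound.
have R11_bound := sigma_row_block_ge R12 l0 hR11_unit.
have pos (d : nat) (x s : R) : 0 <= x -> 0 <= s -> 1 <= d%:R * x ^+ 2 * s ^+ 2 ->
    0 < x /\ 0 < s.
  move=> x0 s0 xs; rewrite !lt_def x0 s0 !andbT; split; apply/eqP => z0; move: xs;
    by rewrite z0 expr0n !(mulr0, mul0r) ler10.
have [h0 s0] := pos _ _ _ (norm12_ge0 _) (sigma_ge0 _ _) Rh_bound.
have [h10 sl0] := pos _ _ _ (norm12_ge0 _) (sigma_ge0 _ _) R11_bound.
rewrite -/Rt in R11_bound sl0.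
have sk0 : 0 < sigma k Rt by apply: lt_le_trans sl0 (le_sigma _ _).
have hh1 : norm12 (invmx R11)^T <= norm12 (invmx Rh)^T.
  exact: norm12_pivot_inv_ge.
have tauE : tau = norm2 R22 / sigma l.+1 A.
  by rewrite /tau /g1 /g2; field; rewrite al0 !gt_eqF.
have g12 : g1 * g2 = norm12 R22 * norm12 (invmx Rh)^T.
  by rewrite /g1 /g2; field.
have taubE : norm2 R22 / sigma k Rt <= taub.
  have -> : taub = norm12 (invmx Rh)^T / norm12 (invmx R11)^T * (norm2 R22 / sigma k Rt).
    by rewrite /taub /tauh g12; field; rewrite !gt_eqF.
  rewrite ler_peMl ?divr_ge0 ?sigma_ge0 //.
  by rewrite ler_pdivlMr // mul1r.
split.
- rewrite tauE g12; apply: ratio_le_sqrt => //; rewrite ?norm12_ge0 //.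
- have -> : tauh = norm12 (invmx Rh)^T / norm12 (invmx R11)^T *
                   (norm2 R22 / sigma l Rt).
    by rewrite /tauh g12; field; rewrite !gt_eqF.
  have /(ler_wpM2l (ltW (divr_gt0 h0 h10))) : norm2 R22 / sigma l Rt <=
      norm12 R22 * norm12 (invmx R11)^T * Num.sqrt (l * (n - l))%:R.
    by apply: ratio_le_sqrt => //; rewrite ?norm12_ge0.
  congr (_ <= _); rewrite g12; field; rewrite gt_eqF //.
- move=> j j1 jk; have jl := leq_trans jk hkl.
  have jn : (0 < j <= n)%N by rewrite j1 (leq_trans jl) // ltnW.
  apply: (@sigma_lower_bound_scalar _ _ _ (norm2 R22)) => //.
  + by apply: lt_le_trans s0 (le_sigma _ _); rewrite leqW.
  + by apply: lt_le_trans sk0 (le_sigma _ _).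
  + by rewrite sigmaA // sigma_partial_qr_le // nE.
  + apply: le_trans taubE; rewrite ler_wpM2l // lef_pV2 ?posrE //; first exact: le_sigma.
    by apply: lt_le_trans sk0 (le_sigma _ _).
- have kn : (0 < k.+1 <= n)%N by rewrite (leq_ltn_trans hkl).
  have sk10 : 0 < sigma k.+1 A by apply: lt_le_trans s0 (le_sigma _ _).
  rewrite hA -mulmxBr /blocks_mx castmx_sub /norm2.
  rewrite -[Q *m _]mulmx1 sigma_mul_orthogonal //; last 2 first.
  + exact: orthogonal_mx1.
  + by rewrite (leq_ltn_trans _ hln).
  rewrite sigma_castmx -ler_sqr ?nnegrE ?mulr_ge0 ?sigma_ge0 ?sqrtr_ge0 //.
  apply: le_trans (truncation_error_le R22 hRt_k) _.
  set t := _ * _ ^+ 2; have t0 : 0 <= 1 + t by rewrite addr_ge0 // mulr_ge0 ?sqr_ge0.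
  rewrite [leRHS]exprMn (sqr_sqrtr t0) /t.
  have -> : sigma k.+1 A ^+ 2 * (1 + tau ^+ 2 * (sigma l.+1 A / sigma k.+1 A) ^+ 2) =
     sigma k.+1 A ^+ 2 + norm2 R22 ^+ 2.
    by rewrite tauE; field; rewrite !gt_eqF.
  by rewrite lerD2r sigmaA // ler_sqr ?nnegrE ?sigma_ge0 // sigma_row_block_le // nE.
Qed.
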